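(* Let $H$ be a graph. Then $\#\mathrm{Hom}(H)\le\#\mathrm{Comp}(H)$.
   Context: Graphs are finite, undirected, possibly with loops; irreflexive means no loops. A homomorphism $h:V(G)\to V(H)$ maps each edge of $G$ to an edge of $H$. It uses an edge $\{w_1,w_2\}\in E(H)$ if some $\{u_1,u_2\}\in E(G)$ has $h(u_1)=w_1,h(u_2)=w_2$; a compaction is a homomorphism that uses every vertex of $H$ and every non-loop edge of $H$. $\#\mathrm{Hom}(H)$: given an irreflexive graph $G$, output the number of homomorphisms from $G$ to $H$. $\#\mathrm{Comp}(H)$: given an irreflexive graph $G$, output the number of compactions from $G$ to $H$. $P_1\le P_2$ means there is a polynomial-time Turing reduction from $P_1$ to $P_2$. *)

(* Defs.v *)
From HB Require Import structures.
From mathcomp Require Import all_boot all_order all_algebra.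
Set Implicit Arguments. Unset Strict Implicit. Unset Printing Implicit Defensive.

(** * Graphs, homomorphisms and compactions *)

Record graph := Graph {
  vertex :> finType;
  adj : rel vertex;
  adj_sym : symmetric adj }.

Arguments adj : clear implicits.

Section Homomorphisms.
Variables G H : graph.
Implicit Type h : {ffun G -> H}.

Definition is_hom h := [forall u1, forall u2, adj G u1 u2 ==> adj H (h u1) (h u2)].

Definition uses_vertex h (w : H) := [exists u, h u == w].

Definition uses_edge h (w1 w2 : H) :=
  [exists u1, exists u2, [&& adj G u1 u2, h u1 == w1 & h u2 == w2]].

Definition is_compaction h :=
  [&& is_hom h,
      [forall w, uses_vertex h w]
    & [forall w1, forall w2, (w1 != w2) && adj H w1 w2 ==> uses_edge h w1 w2]].

Definition num_hom := #|[set h | is_hom h]|.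
Definition num_compaction := #|[set h | is_compaction h]|.

End Homomorphisms.

(** * Counting problems *)

Record counting_problem := CountingProblem {
  instance : Type;
  encode : instance -> seq bool;
  answer : instance -> nat }.

Record irreflexive_graph := IrreflexiveGraph {
  graph_order : nat;
  iadj : rel 'I_graph_order;
  iadj_sym : symmetric iadj;
  iadj_irrefl : irreflexive iadj }.

Arguments iadj : clear implicits.

Coercion graph_of (G : irreflexive_graph) : graph := Graph (@iadj_sym G).

(** The order n in unary, closed by a 0, then the strict upper triangle of the
    adjacency matrix read column by column: (0,1), (0,2), (1,2), (0,3), ... *)
Definition encode_graph (G : irreflexive_graph) : seq bool :=
  nseq (graph_order G) true ++ false ::
  [seq iadj G i j | j <- enum 'I_(graph_order G),
                    i <- [seq i : 'I_(graph_order G) <-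
                            enum 'I_(graph_order G) | i < j]].

Definition count_hom (H : graph) : counting_problem :=
  CountingProblem encode_graph (fun G => num_hom G H).

Definition count_comp (H : graph) : counting_problem :=
  CountingProblem encode_graph (fun G => num_compaction G H).

(** Binary expansion, least significant bit first; [up_log 2 n.+1] is the number
    of binary digits of [n] (none for 0). *)
Definition bits_of_nat (n : nat) : seq bool :=
  mkseq (fun i => odd (n %/ 2 ^ i)) (up_log 2 n.+1).

(** * Multi-tape oracle Turing machines over {0, 1, blank} *)

(** [None] is the blank. *)
Definition cell := option bool.

(** A two-way infinite tape: [tape_right] starts at the scanned cell, [tape_left]
    lists the cells to its left, nearest first; all cells not listed are blank. *)
Record tape := Tape { tape_left : seq cell; tape_right : seq cell }.

Variant direction := MoveLeft | Stay | MoveRight.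

Definition read (t : tape) : cell := head None (tape_right t).

Definition write (c : cell) (t : tape) : tape :=
  Tape (tape_left t) (c :: behead (tape_right t)).

Definition move_head (d : direction) (t : tape) : tape :=
  match d with
  | MoveLeft => Tape (behead (tape_left t)) (head None (tape_left t) :: tape_right t)
  | Stay => t
  | MoveRight => Tape (read t :: tape_left t) (behead (tape_right t))
  end.

Definition load (w : seq bool) : tape := Tape [::] (map Some w).

Fixpoint bits_before_blank (s : seq cell) : seq bool :=
  if s is Some b :: s' then b :: bits_before_blank s' else [::].

(** The word that starts at the scanned cell. *)
Definition contents (t : tape) : seq bool := bits_before_blank (tape_right t).

Variant instruction (Q I : Type) :=
  | Halt
  | Query of Q
  | Step of ((I -> cell) -> Q * (I -> cell * direction)).

Arguments Halt {Q I}.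
Arguments Query {Q I}.
Arguments Step {Q I}.

Record oracle_machine := OracleMachine {
  state : finType;
  tape_index : finType;
  input_tape : tape_index;
  oracle_tape : tape_index;
  output_tape : tape_index;
  start : state;
  control : state -> instruction state tape_index }.

Section Semantics.
Variables (M : oracle_machine) (O : seq bool -> seq bool).

Definition configuration : Type := state M * (tape_index M -> tape).

Definition initial (w : seq bool) : configuration :=
  (start M, fun i => if i == input_tape M then load w else load [::]).

(** A query takes one step: it replaces the whole oracle tape, whose contents are
    the query, by the answer. *)
Definition step (c : configuration) : configuration :=
  let: (q, ts) := c in
  match control q with
  | Halt => c
  | Query q' =>
      (q', fun i => if i == oracle_tape M then load (O (contents (ts i))) else ts i)
  | Step delta =>
      let: (q', act) := delta (fun i => read (ts i)) in
      (q', fun i => move_head (act i).2 (write (act i).1 (ts i)))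
  end.

Definition halted (c : configuration) : bool :=
  if control c.1 is Halt then true else false.

Definition outputs_within (w : seq bool) (time : nat) (v : seq bool) : Prop :=
  exists2 t, t <= time &
    let c := iter t step (initial w) in
    halted c /\ contents (c.2 (output_tape M)) = v.

End Semantics.

(** * Polynomial-time Turing reductions *)

(** Nothing is assumed about the answers to words that encode no instance of [P]. *)
Definition oracle_for (P : counting_problem) (O : seq bool -> seq bool) : Prop :=
  forall x : instance P, O (encode x) = bits_of_nat (answer x).

Definition poly_time_Turing_reducible (P1 P2 : counting_problem) : Prop :=
  exists (M : oracle_machine) (p : {poly nat}),
  forall O : seq bool -> seq bool, oracle_for P2 O ->
  forall x : instance P1,
    outputs_within M O (encode x) p.[size (encode x)]%R (bits_of_nat (answer x)).

(* Main.v *)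
Require Import Defs.
From Stdlib Require Import FunctionalExtensionality.
From HB Require Import structures.
From mathcomp Require Import all_boot all_order all_algebra.
From mathcomp Require Import zify ring.
Set Implicit Arguments. Unset Strict Implicit. Unset Printing Implicit Defensive.
Import Order.TTheory GRing.Theory Num.Theory.

(** Inclusion-exclusion over the set A of vertices and non-loop edges of H that
    are left unused writes the number of compactions from G to H as a signed sum
    of the numbers of homomorphisms avoiding A. The latter are multiplicative in
    disjoint unions, so adding t copies of a gadget J to G turns the A-term into
    hom_A(G) * hom_A(J)^t. If every required vertex and edge is used by some
    homomorphism from J, then hom_A(J) is strictly largest at A empty, and a fixed
    integer combination of finitely many values of t yields d * hom(G) for a
    constant d > 0.

    The columns of new vertices come last in the encoding, so the queries are
    written in linear time. Writing d = 2^a m with m odd, the combination is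
    divided by m in one pass over all the answers, least significant bit first,
    with a bounded carry, and the a lowest bits are dropped. *)

(** * Disjoint unions and inclusion-exclusion *)

Lemma split_lshift m n (i : 'I_m) : split (lshift n i) = inl i.
Proof. exact: (unsplitK (inl i)). Qed.

Lemma split_rshift m n (i : 'I_n) : split (rshift m i) = inr i.
Proof. exact: (unsplitK (inr i)). Qed.

Section DisjointUnion.
Variables G K : irreflexive_graph.
Local Notation n := (graph_order G).
Local Notation m := (graph_order K).

Definition dunion_adj : rel 'I_(n + m) := fun i j =>
  match split i, split j with
  | inl a, inl b => iadj G a b
  | inr a, inr b => iadj K a b
  | _, _ => false
  end.

Lemma dunion_adj_sym : symmetric dunion_adj.
Proof.
move=> i j; rewrite /dunion_adj.
by case: (split i) (split j) => a [] b //; rewrite iadj_sym.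
Qed.

Lemma dunion_adj_irrefl : irreflexive dunion_adj.
Proof. by move=> i; rewrite /dunion_adj; case: (split i) => a; rewrite iadj_irrefl. Qed.

Definition dunion := IrreflexiveGraph dunion_adj_sym dunion_adj_irrefl.

Lemma dunion_adj_ll a b : dunion_adj (lshift m a) (lshift m b) = iadj G a b.
Proof. by rewrite /dunion_adj !split_lshift. Qed.

Lemma dunion_adj_rr a b : dunion_adj (rshift n a) (rshift n b) = iadj K a b.
Proof. by rewrite /dunion_adj !split_rshift. Qed.

Lemma dunion_adj_lr a b : dunion_adj (lshift m a) (rshift n b) = false.
Proof. by rewrite /dunion_adj split_lshift split_rshift. Qed.

Lemma dunion_adj_rl a b : dunion_adj (rshift n a) (lshift m b) = false.
Proof. by rewrite /dunion_adj split_lshift split_rshift. Qed.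

Definition dunion_adjE := (dunion_adj_ll, dunion_adj_rr, dunion_adj_lr, dunion_adj_rl).

End DisjointUnion.

Lemma forall_ord_add m n (P : pred 'I_(m + n)) :
  [forall i, P i] = [forall i, P (lshift n i)] && [forall i, P (rshift m i)].
Proof.
apply/forallP/andP => [HP | [/forallP Hl /forallP Hr] i].
  by split; apply/forallP => i.
by case: (split_ordP i) => j ->.
Qed.

Lemma exists_ord_add m n (P : pred 'I_(m + n)) :
  [exists i, P i] = [exists i, P (lshift n i)] || [exists i, P (rshift m i)].
Proof.
apply: negb_inj; rewrite negb_or !negb_exists forall_ord_add //.
Qed.

Lemma enum_ord_add m n :
  enum 'I_(m + n) = map (@lshift m n) (enum 'I_m) ++ map (@rshift m n) (enum 'I_n).
Proof.
apply: (inj_map (@ord_inj _)); rewrite [LHS]val_enum_ord map_cat iotaD.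
rewrite -[X in _ = X ++ _]map_comp -[X in _ = _ ++ X]map_comp.
congr (_ ++ _); first by rewrite -[LHS]val_enum_ord.
rewrite -[X in iota X _]addn0 iotaDl -[X in map _ X]val_enum_ord -map_comp.
exact: eq_map.
Qed.

Definition graph_column (G : irreflexive_graph) (j : 'I_(graph_order G)) : seq bool :=
  [seq iadj G i j | i <- [seq i : 'I_(graph_order G) <- enum 'I_(graph_order G) | i < j]].

Definition triangle (G : irreflexive_graph) : seq bool :=
  flatten [seq graph_column j | j <- enum 'I_(graph_order G)].

Lemma encode_graphE G :
  encode_graph G = nseq (graph_order G) true ++ false :: triangle G.
Proof. by []. Qed.

(** The vertices of [K] are numbered after those of [G], so the old triangle survives as a prefix,
    and a new column starts with one 0 per vertex of [G], as no edge joins the two sides. *)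
Lemma triangle_dunion G K :
  triangle (dunion G K) = triangle G ++
    flatten [seq nseq (graph_order G) false ++ graph_column j
            | j <- enum 'I_(graph_order K)].
Proof.
rewrite /triangle /= enum_ord_add map_cat flatten_cat -!map_comp.
congr (flatten _ ++ flatten _); apply: eq_map => j /=; rewrite /graph_column /=.
  rewrite enum_ord_add filter_cat map_cat -[RHS]cats0; congr (_ ++ _).
    rewrite filter_map -map_comp; apply: eq_map => i /=.
    exact: dunion_adj_ll.
  rewrite filter_map (eq_filter (a2 := pred0)) ?filter_pred0 // => i /=.
  by have := ltn_ord j; lia.
rewrite enum_ord_add filter_cat map_cat; congr (_ ++ _).
  rewrite filter_map (eq_filter (a2 := predT)) ?filter_predT => [|i /=].
    rewrite -map_comp (eq_map (g := fun=> false)) => [|i /=]; last exact: dunion_adj_lr.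
    rewrite -[X in nseq X _](size_enum_ord (graph_order G)).
    by elim: (enum _) => //= i s ->.
  by have := ltn_ord i; lia.
rewrite filter_map -map_comp (eq_filter (a2 := fun i : 'I__ => i < j)) => [|i /=]; last first.
  by rewrite ltn_add2l.
by apply: eq_map => i /=; exact: dunion_adj_rr.
Qed.

Section InclusionExclusion.
Variable H : graph.

Definition feature : finType := (H + H * H)%type.

Definition used (G : graph) (h : {ffun G -> H}) (x : feature) : bool :=
  match x with
  | inl w => uses_vertex h w
  | inr (w1, w2) => uses_edge h w1 w2
  end.

Definition required (x : feature) : bool :=
  if x is inr (w1, w2) then (w1 != w2) && adj H w1 w2 else true.

Definition avoids (G : graph) (A : {set feature}) (h : {ffun G -> H}) :=
  is_hom h && [forall x in A, ~~ used h x].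

Definition num_avoiding (G : graph) (A : {set feature}) := #|[set h | @avoids G A h]|.

Lemma is_compactionE (G : graph) (h : {ffun G -> H}) :
  is_compaction h = is_hom h && [forall x, required x ==> used h x].
Proof.
rewrite /is_compaction; congr (_ && _).
apply/andP/forallP => [[/forallP Hv /forallP He] [w|[w1 w2]] /= | HP].
- exact: Hv.
- by have /forallP := He w1; apply.
- split; first by apply/forallP => w; have := HP (inl w).
  by apply/forallP=> w1; apply/forallP=> w2; have := HP (inr (w1, w2)).
Qed.

Lemma num_avoiding0 (G : graph) : num_avoiding G set0 = num_hom G H.
Proof.
congr #|pred_of_set _|; apply/setP => h; rewrite !inE /avoids.
by case: is_hom => //=; apply/forallP => x; rewrite inE.
Qed.

Local Open Scope ring_scope.

(** This is (-1)^|A| if every member of [A] is required; otherwise a zero factor discards [A]. *)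
Definition weight (A : {set feature}) : int := \prod_(x in A) - (required x)%:R.

Lemma num_compaction_sum (G : graph) :
  (num_compaction G H)%:R = \sum_(A : {set feature}) weight A * (num_avoiding G A)%:R
    :> int.
Proof.
have card_sum (P : pred {ffun G -> H}) : #|[set h | P h]|%:R = \sum_h (P h)%:R :> int.
  by rewrite -sum1_card natr_sum big_mkcond; apply: eq_bigr => h _; rewrite inE; case: (P h).
transitivity (\sum_(A : {set feature}) \sum_h weight A * (avoids (G := G) A h)%:R);
  last by apply: eq_bigr => A _; rewrite -mulr_sumr card_sum.
rewrite exchange_big /num_compaction card_sum; apply: eq_bigr => h _ /=.
rewrite is_compactionE /avoids; case: is_hom => /=; last first.
  by rewrite big1 // => A _; rewrite mulr0.
transitivity (\prod_(x : feature) (- (required x && ~~ used h x)%:R + 1 : int)).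
  case: forallP => [Hx | /forallP].
    by rewrite big1 // => x _; have := Hx x; case: required => //= ->.
  rewrite negb_forall => /existsP[x]; rewrite negb_imply => Hx.
  by rewrite (bigD1 x) //= Hx mul0r.
rewrite bigA_distr; apply: eq_bigr => A _; rewrite -big_mkcond /weight /=.
transitivity (\prod_(x in A) ((- (required x)%:R : int) * (~~ used h x)%:R)).
  by apply: eq_bigr => x _; rewrite mulNr -natrM mulnb.
rewrite big_split /=; congr (_ * _); case: forall_inP => [Hx | /forall_inP].
  by rewrite big1 // => x /Hx ->.
rewrite negb_forall => /existsP[x]; rewrite negb_imply => /andP[xA /negbTE Hx].
by rewrite (bigD1 x) //= Hx mul0r.
Qed.

Local Close Scope ring_scope.

(** A map on the disjoint union is the pair of its two restrictions. Every edge lies on one side, so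
    being a homomorphism and avoiding [A] are both tested on each side separately. *)
Lemma num_avoiding_dunion (G K : irreflexive_graph) A :
  num_avoiding (dunion G K) A = num_avoiding G A * num_avoiding K A.
Proof.
pose fl (h : {ffun dunion G K -> H}) : {ffun G -> H} := [ffun i => h (lshift _ i)].
pose fr (h : {ffun dunion G K -> H}) : {ffun K -> H} := [ffun i => h (rshift _ i)].
have homE h : is_hom h = is_hom (fl h) && is_hom (fr h).
  rewrite /is_hom forall_ord_add; congr (_ && _); apply: eq_forallb => i;
    rewrite forall_ord_add /=.
    rewrite [X in _ && X](_ : _ = true) ?andbT; last by apply/forallP => j; rewrite dunion_adjE.
    by apply: eq_forallb => j; rewrite dunion_adjE !ffunE.
  rewrite [X in X && _](_ : _ = true); last by apply/forallP => j; rewrite dunion_adjE.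
  by apply: eq_forallb => j; rewrite dunion_adjE !ffunE.
have usedE h x : used h x = used (fl h) x || used (fr h) x.
  case: x => [w|[w1 w2]] /=.
    rewrite /uses_vertex exists_ord_add; congr (_ || _); apply: eq_existsb => i;
    by rewrite ffunE.
  rewrite /uses_edge exists_ord_add; congr (_ || _); apply: eq_existsb => i;
    rewrite exists_ord_add /=.
    rewrite [X in _ || X](_ : _ = false) ?orbF; last first.
      by apply/existsP => -[j]; rewrite dunion_adjE.
    by apply: eq_existsb => j; rewrite dunion_adjE !ffunE.
  rewrite [X in X || _](_ : _ = false); last first.
    by apply/existsP => -[j]; rewrite dunion_adjE.
  by apply: eq_existsb => j; rewrite dunion_adjE !ffunE.
have avoidE h : avoids A h = avoids A (fl h) && avoids A (fr h).
  rewrite /avoids homE andbACA; congr (_ && _).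
  apply/forall_inP/andP => [Hx | [/forall_inP Hl /forall_inP Hr] x xA].
    by split; apply/forall_inP => x /Hx; rewrite usedE negb_or => /andP[].
  by rewrite usedE negb_or Hl ?Hr.
rewrite /num_avoiding -cardsX.
pose f h := (fl h, fr h).
have f_inj : injective f.
  move=> h h' [/ffunP el /ffunP er]; apply/ffunP => i.
  by case: (split_ordP i) => j ->; [have := el j | have := er j]; rewrite !ffunE.
rewrite -(card_imset _ f_inj); apply: eq_card => -[h1 h2]; rewrite !inE /=.
apply/imsetP/idP => [[h] | Hh].
  by rewrite inE avoidE => Hh [-> ->].
pose h : {ffun dunion G K -> H} :=
  [ffun i => match split i with inl a => h1 a | inr b => h2 b end].
have El : fl h = h1 by apply/ffunP => i; rewrite !ffunE split_lshift.
have Er : fr h = h2 by apply/ffunP => i; rewrite !ffunE split_rshift.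
by exists h; rewrite ?inE ?avoidE /f ?El ?Er.
Qed.

(** * Copies of a gadget and interpolation *)

Definition empty_graph : irreflexive_graph.
Proof. by refine (@IrreflexiveGraph 0 (fun _ _ => false) _ _). Defined.

Definition copies J t := iter t (dunion^~ J) empty_graph.

Lemma num_avoiding_empty A : num_avoiding empty_graph A = 1.
Proof.
rewrite /num_avoiding (_ : [set h | _] = setT).
  by rewrite cardsT card_ffun card_ord.
apply/setP => h; rewrite !inE /avoids; apply/andP; split.
  by apply/forallP => -[].
by apply/forallP => -[w|[w1 w2]]; apply/implyP => _; apply/existsP => -[[]].
Qed.

Lemma num_avoiding_copies J t A : num_avoiding (copies J t) A = num_avoiding J A ^ t.
Proof.
elim: t => [|t IH]; first exact: num_avoiding_empty.
by rewrite /= num_avoiding_dunion IH expnSr.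
Qed.

Definition has_edge := [exists w1, exists w2, adj H w1 w2].

(* An isolated vertex and a disjoint edge; the edge is left out when H has none,
   for otherwise the gadget would admit no homomorphism. *)
Definition gadget_adj : rel 'I_3 := fun i j =>
  has_edge && ((i == 1 :> nat) && (j == 2 :> nat) || (i == 2 :> nat) && (j == 1 :> nat)).

Lemma gadget_adj_sym : symmetric gadget_adj.
Proof.
move=> i j; rewrite /gadget_adj; congr (_ && _).
by rewrite orbC andbC [X in _ || X]andbC.
Qed.

Lemma gadget_adj_irrefl : irreflexive gadget_adj.
Proof. by move=> i; rewrite /gadget_adj; case: i => [[|[|[]]]] //=; rewrite andbF. Qed.

Definition gadget := IrreflexiveGraph gadget_adj_sym gadget_adj_irrefl.

(** Vertex 0 is isolated and can be sent anywhere in [H]; the edge between 1 and 2 can be sent onto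
    any edge of [H]. *)
Lemma gadget_uses x : required x -> exists2 h : {ffun gadget -> H}, is_hom h & used h x.
Proof.
pose mk a b c : {ffun gadget -> H} :=
  [ffun i : 'I_3 => if i == 0 :> nat then a else if i == 1 :> nat then b else c].
have mk_hom a b c : (has_edge -> adj H b c) -> is_hom (mk a b c).
  move=> Hbc; apply/forallP => i; apply/forallP => j; apply/implyP.
  rewrite /= /gadget_adj => /andP[/Hbc bc] /orP[] /andP[/eqP Ei /eqP Ej];
    rewrite !ffunE Ei Ej //=; by rewrite adj_sym.
case: x => [w|[w1 w2]] /= Hx.
  have [/existsP[a /existsP[b ab]] | noe] := boolP has_edge.
    exists (mk w a b); first exact: mk_hom.
    by apply/existsP; exists (ord0 : 'I_3); rewrite ffunE.
  exists (mk w w w); first by apply: mk_hom; rewrite (negbTE noe).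
  by apply/existsP; exists (ord0 : 'I_3); rewrite ffunE.
case/andP: Hx => _ Hx; exists (mk w1 w1 w2); first by apply: mk_hom.
apply/existsP; exists (inord 1 : 'I_3); apply/existsP; exists (inord 2 : 'I_3).
rewrite !ffunE !inordK //= !eqxx !andbT /gadget_adj !inordK //= andbT.
by apply/existsP; exists w1; apply/existsP; exists w2.
Qed.

(** A homomorphism using some member of [A] is counted on the right but not on the left; it exists
    because that member is required. *)
Lemma num_avoiding_gadget_lt (A : {set feature}) :
  A != set0 -> {in A, forall x, required x} ->
  num_avoiding gadget A < num_avoiding gadget set0.
Proof.
case/set0Pn => x xA Hreq; have [h hom_h Hu] := gadget_uses (Hreq x xA).
apply: proper_card; apply/properP; split.
  apply/subsetP => g; rewrite !inE /avoids => /andP[-> _] /=.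
  by apply/forallP => y; rewrite inE.
exists h; rewrite !inE /avoids hom_h /=; first by apply/forallP => y; rewrite inE.
by apply/forall_inP => /(_ x xA); rewrite Hu.
Qed.

Local Open Scope ring_scope.

(* With c_A the number of maps from the gadget avoiding A, the coefficients l
   are those of the product of the X - c_A over nonempty A, which kills every
   term of the inclusion-exclusion sum but the one for the empty set. *)
Lemma num_hom_interpolation :
  exists (k : nat) (l : 'I_k -> int) (K : 'I_k -> irreflexive_graph) (d : nat),
  (0 < d)%N /\ forall G : irreflexive_graph,
    d%:R * (num_hom G H)%:R = \sum_t l t * (num_compaction (dunion G (K t)) H)%:R :> int.
Proof.
pose c A : int := (num_avoiding gadget A)%:R.
pose P A := (A != set0) && [forall x in A, required x].
pose L : {poly int} := \prod_(A : {set feature} | P A) ('X - (c A)%:P).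
(* Either all members of [A] are required and [c A] is a root of [L], or [weight A] is zero. *)
have L0 A : A != set0 -> weight A * L.[c A] = 0.
  move=> An0; have [HA | ] := boolP [forall x in A, required x].
    by rewrite horner_prod (bigD1 A) /= ?/P ?An0 // hornerXsubC subrr mul0r mulr0.
  rewrite negb_forall => /existsP[x]; rewrite negb_imply => /andP[xA /negbTE Hx].
  by rewrite /weight (bigD1 x) //= Hx oppr0 !mul0r.
(* Every factor is positive because the count is strictly largest at the empty set. *)
have Lgt0 : 0 < L.[c set0].
  rewrite horner_prod; apply: prodr_gt0 => A /andP[An0 /forall_inP HA].
  by rewrite hornerXsubC subr_gt0 ltr_nat num_avoiding_gadget_lt.
(* With t copies of the gadget the A-term gains the factor [c A ^+ t], so weighting by the
   coefficients of [L] produces [L.[c A]]. *)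
exists (size L), (fun t => L`_t), (fun t => copies gadget t), `|L.[c set0]|%N.
split=> [|G]; first by rewrite absz_gt0 gt_eqF.
rewrite natz gtz0_abs //.
transitivity (\sum_(A : {set feature}) weight A * (num_avoiding G A)%:R * L.[c A]).
  rewrite (bigD1 set0) //= big1 ?addr0 => [|A An0]; last first.
    by rewrite mulrAC L0 // mul0r.
  by rewrite num_avoiding0 /weight big_set0 mul1r mulrC.
under eq_bigr => A _ do rewrite horner_coef mulr_sumr.
rewrite exchange_big; apply: eq_bigr => t _ /=.
rewrite num_compaction_sum mulr_sumr; apply: eq_bigr => A _.
rewrite num_avoiding_dunion num_avoiding_copies natrM natrX -/(c A); ring.
Qed.

End InclusionExclusion.

(** * Programs for oracle machines *)

(* Equality up to trailing blanks, which the list representation of tapes keeps. *)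
Definition tape_eq (t u : tape) :=
  nth None (tape_left t) =1 nth None (tape_left u)
  /\ nth None (tape_right t) =1 nth None (tape_right u).

Lemma tape_eq_refl t : tape_eq t t. Proof. by []. Qed.
#[local] Hint Resolve tape_eq_refl : core.

Lemma tape_eq_sym t u : tape_eq t u -> tape_eq u t.
Proof. by case=> e1 e2; split=> i; rewrite ?e1 ?e2. Qed.

Lemma tape_eq_trans t u v : tape_eq t u -> tape_eq u v -> tape_eq t v.
Proof. by case=> e1 e2 [e3 e4]; split=> i; rewrite ?e1 ?e2 ?e3 ?e4. Qed.

Lemma tape_eq_read t u : tape_eq t u -> read t = read u.
Proof. by case=> _ e; rewrite /read -!nth0 e. Qed.

Lemma tape_eq_write c t u : tape_eq t u -> tape_eq (write c t) (write c u).
Proof. by case=> e1 e2; split=> // -[|i] //=; rewrite !nth_behead e2. Qed.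

Lemma tape_eq_move d t u : tape_eq t u -> tape_eq (move_head d t) (move_head d u).
Proof.
move=> e; have re := tape_eq_read e; case: e => e1 e2.
case: d => //; split=> /= -[|i] //=; rewrite ?nth_behead -?nth0 //.
Qed.

Lemma tape_eq_write_read t : tape_eq (write (read t) t) t.
Proof. by split=> // i; case: t => l [|x r] //=; case: i => [|[]]. Qed.

Lemma tape_eq_contents t u : tape_eq t u -> contents t = contents u.
Proof.
rewrite /contents => -[_]; move: (tape_right t) (tape_right u).
elim=> [|x s IH] [|y s'] e //=.
- by have /= <- := e 0.
- by have /= -> := e 0.
- have /= -> := e 0; case: y {e} (fun i => e i.+1) => [b|] //= e.
  by rewrite (IH s').
Qed.

Lemma contents_word l w : contents (Tape l (map Some w)) = w.
Proof. by rewrite /contents /=; elim: w => //= b w ->. Qed.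

Section Programs.
Variables I S : finType.

(* A program is a sequence of instructions. [Loop f] repeats the action given by f,
   on the register and the scanned cells, until f returns [false], performing the
   last action too. *)
Variant instr :=
  | Loop of S -> (I -> cell) -> bool * S * (I -> cell * direction)
  | Ask.

Variables input oracle output : I.

Definition upd (a : I -> cell * direction) (ts : I -> tape) i :=
  move_head (a i).2 (write (a i).1 (ts i)).

Section Machine.
Variables (p : seq instr) (s0 : S).

(** The state pairs a program counter with the register; a counter equal to [size p] means
    halting. *)
Definition program_control (q : 'I_(size p).+1 * S) :
    instruction ('I_(size p).+1 * S)%type I :=
  match drop q.1 p with
  | [::] => Halt
  | Loop f :: _ => Step (fun r =>
      let: (again, s, a) := f q.2 r in
      ((if again then q.1 else inord q.1.+1, s), a))
  | Ask :: _ => Query (inord q.1.+1, q.2)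
  end.

Definition program_machine : oracle_machine :=
  @OracleMachine _ I input oracle output (ord0, s0) program_control.

End Machine.

Variable O : seq bool -> seq bool.

Definition asked (ts : I -> tape) i :=
  if i == oracle then load (O (contents (ts i))) else ts i.

(* [exec p n s ts s' ts']: run from register s and tapes ts, the program p stops
   within n steps; every test of a loop is carried out together with its action. *)
Inductive exec : seq instr -> nat -> S -> (I -> tape) -> S -> (I -> tape) -> Prop :=
  | exec_nil n s ts ts' :
      (forall i, tape_eq (ts i) (ts' i)) -> exec [::] n s ts s ts'
  | exec_exit f p n s ts s1 a s' ts' :
      f s (fun i => read (ts i)) = (false, s1, a) ->
      exec p n s1 (upd a ts) s' ts' -> exec (Loop f :: p) n.+1 s ts s' ts'
  | exec_again f p n s ts s1 a s' ts' :
      f s (fun i => read (ts i)) = (true, s1, a) ->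
      exec (Loop f :: p) n s1 (upd a ts) s' ts' ->
      exec (Loop f :: p) n.+1 s ts s' ts'
  | exec_ask p n s ts s' ts' :
      exec p n s (asked ts) s' ts' -> exec (Ask :: p) n.+1 s ts s' ts'.

Lemma upd_tape_eq a ts us : (forall i, tape_eq (ts i) (us i)) ->
  forall i, tape_eq (upd a ts i) (upd a us i).
Proof. by move=> e i; apply/tape_eq_move/tape_eq_write. Qed.

Lemma asked_tape_eq ts us : (forall i, tape_eq (ts i) (us i)) ->
  forall i, tape_eq (asked ts i) (asked us i).
Proof.
by move=> e i; rewrite /asked; case: eqP => // _; rewrite (tape_eq_contents (e i)).
Qed.

Lemma reads_tape_eq ts us : (forall i, tape_eq (ts i) (us i)) ->
  (fun i : I => read (ts i)) = (fun i => read (us i)).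
Proof. by move=> e; apply: functional_extensionality => i; apply: tape_eq_read. Qed.

(** A run depends on the tapes only through scanned cells and queried words, neither of which sees
    trailing blanks. *)
Lemma exec_tape_eq p n s ts us s' ts' : (forall i, tape_eq (us i) (ts i)) ->
  exec p n s ts s' ts' -> exec p n s us s' ts'.
Proof.
move=> e ex; elim: ex us e => {p n s ts s' ts'}
  [n s ts ts' e' | f p n s ts s1 a s' ts' Ef _ IH | f p n s ts s1 a s' ts' Ef _ IH
  | p n s ts s' ts' _ IH] us e.
- by apply: exec_nil => i; apply: tape_eq_trans (e i) (e' i).
- by apply: exec_exit (IH _ (upd_tape_eq a e)); rewrite (reads_tape_eq e).
- by apply: exec_again (IH _ (upd_tape_eq a e)); rewrite (reads_tape_eq e).
- exact/exec_ask/IH/asked_tape_eq.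
Qed.

Lemma exec_leq p n m s ts s' ts' : n <= m ->
  exec p n s ts s' ts' -> exec p m s ts s' ts'.
Proof.
move=> le_nm ex; elim: ex m le_nm => {p n s ts s' ts'}
  [n s ts ts' e' | f p n s ts s1 a s' ts' Ef _ IH | f p n s ts s1 a s' ts' Ef _ IH
  | p n s ts s' ts' _ IH] [|m] // le_nm; try exact: exec_nil.
- exact: exec_exit Ef (IH _ _).
- exact: exec_again Ef (IH _ _).
- exact/exec_ask/IH.
Qed.

Lemma exec_cat p n s ts s1 ts1 q m s2 ts2 :
  exec p n s ts s1 ts1 -> exec q m s1 ts1 s2 ts2 ->
  exec (p ++ q) (n + m) s ts s2 ts2.
Proof.
move=> ex exq; elim: ex exq => {p n s ts s1 ts1}
  [n s ts ts' e' | f p n s ts s1 a s' ts' Ef _ IH | f p n s ts s1 a s' ts' Ef _ IH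
  | p n s ts s' ts' _ IH] exq /=.
- by apply: exec_leq (leq_addl n m) _; apply: exec_tape_eq exq.
- exact: exec_exit Ef (IH exq).
- exact: exec_again Ef (IH exq).
- exact/exec_ask/IH.
Qed.

Lemma drop_consE (T : Type) (s : seq T) k x s' :
  drop k s = x :: s' -> k < size s /\ drop k.+1 s = s'.
Proof.
move=> e; split; last by rewrite -addn1 addnC -drop_drop e /= drop0.
by rewrite ltnNge; apply/negP => /drop_oversize; rewrite e.
Qed.

(** Induction on the run, where [p] is always the part of [p0] from the counter [pc] onwards. *)
Lemma exec_run p0 s0 p n s ts s' ts' us (pc : 'I_(size p0).+1) :
  exec p n s ts s' ts' -> drop pc p0 = p ->
  (forall i, tape_eq (us i) (ts i)) ->
  let c := iter n (step (M := program_machine p0 s0) O) ((pc, s), us) in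
  halted c /\ forall i, tape_eq (c.2 i) (ts' i).
Proof.
move=> ex; elim: ex us pc => {p n s ts s' ts'}
  [n s ts ts' e' | f p n s ts s1 a s' ts' Ef _ IH | f p n s ts s1 a s' ts' Ef _ IH
  | p n s ts s' ts' _ IH] us pc Ep e.
(* A halting configuration is a fixed point of [step], so the steps left over in the budget change
   nothing. *)
- have Ehalt : program_control (p := p0) (pc, s) = Halt.
    by rewrite /program_control /= Ep.
  rewrite [iter _ _ _](_ : _ = ((pc, s), us)).
    split; first by rewrite /halted /= Ehalt.
    by move=> i; apply: tape_eq_trans (e i) (e' i).
  by elim: n => //= n ->; rewrite /step /= Ehalt.
- have [ltp Ep'] := drop_consE Ep.
  have := IH (upd a us) (inord pc.+1); rewrite inordK // => /(_ Ep' (upd_tape_eq a e)).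
  rewrite iterSr (_ : step (M := program_machine p0 s0) _ _ = ((inord pc.+1, s1), upd a us)) //.
  by rewrite /step /= /program_control /= Ep /= (reads_tape_eq e) Ef.
- have := IH (upd a us) pc Ep (upd_tape_eq a e).
  rewrite iterSr (_ : step (M := program_machine p0 s0) _ _ = ((pc, s1), upd a us)) //.
  by rewrite /step /= /program_control /= Ep /= (reads_tape_eq e) Ef.
- have [ltp Ep'] := drop_consE Ep.
  have := IH (asked us) (inord pc.+1); rewrite inordK // => /(_ Ep' (asked_tape_eq e)).
  rewrite iterSr (_ : step (M := program_machine p0 s0) _ _ = ((inord pc.+1, s), asked us)) //.
  by rewrite /step /= /program_control /= Ep.
Qed.

Lemma exec_outputs_within p s0 w n v s' ts' :
  exec p n s0 (fun i => if i == input then load w else load [::]) s' ts' ->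
  contents (ts' output) = v -> outputs_within (program_machine p s0) O w n v.
Proof.
move=> ex Ev; exists n => //.
have [Hh He] := @exec_run p s0 p n _ _ _ _
  (fun i => if i == input then load w else load [::]) ord0 ex (drop0 p)
  (fun i => tape_eq_refl _).
by split=> //; rewrite -Ev; apply: tape_eq_contents.
Qed.

End Programs.
Arguments Ask {I S}.

(** * Binary expansions, least significant bit first *)

Fixpoint nat_of_bits (s : seq bool) : nat :=
  if s is b :: s' then b + (nat_of_bits s').*2 else 0.

Lemma bits_of_nat0 : bits_of_nat 0 = [::].
Proof. by rewrite /bits_of_nat up_log1. Qed.

Lemma bits_of_nat_gt0 n : 0 < n -> bits_of_nat n = odd n :: bits_of_nat n./2.
Proof.
move=> n_gt0; rewrite /bits_of_nat up_log2S // /mkseq /= divn1; congr (_ :: _).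
rewrite -[1]addn0 iotaDl -map_comp; apply: eq_map => i /=.
by rewrite add1n expnS divnMA divn2.
Qed.

Lemma bits_of_natK n : nat_of_bits (bits_of_nat n) = n.
Proof.
elim/ltn_ind: n => -[|n] IH; first by rewrite bits_of_nat0.
rewrite bits_of_nat_gt0 //= IH; last by lia.
by rewrite -[RHS]odd_double_half.
Qed.

Lemma bits_of_nat_last n : 0 < n -> exists w, bits_of_nat n = rcons w true.
Proof.
elim/ltn_ind: n => -[|n] IH // _; rewrite bits_of_nat_gt0 //.
have [E0 | hgt0] := posnP n.+1./2.
  by exists [::]; rewrite E0 bits_of_nat0; case: n E0 {IH}.
have [||w ->] := IH n.+1./2 => //; last by exists (odd n.+1 :: w).
by lia.
Qed.

(** Leading zeros of the number sit at the end of the word; they are what has to be trimmed after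
    the division. *)
Lemma nat_of_bitsK s :
  exists z, s = bits_of_nat (nat_of_bits s) ++ nseq z false.
Proof.
elim: s => [|b s [z Es]]; first by exists 0; rewrite bits_of_nat0.
have [E0 | gt0] := posnP (nat_of_bits (b :: s)).
  exists z.+1; rewrite E0 bits_of_nat0; move: E0 Es => /=; case: b => //= E0.
  by have -> : nat_of_bits s = 0 by [lia]; rewrite bits_of_nat0 => ->.
exists z; rewrite bits_of_nat_gt0 //= {1}Es; congr (_ :: bits_of_nat _ ++ _).
  by rewrite oddD odd_double addbF; case: b {gt0}.
by rewrite half_bit_double.
Qed.

Lemma drop_bits_of_nat a n : drop a (bits_of_nat (2 ^ a * n)) = bits_of_nat n.
Proof.
case: n => [|n]; first by rewrite muln0 bits_of_nat0.
elim: a => [|a IH]; first by rewrite mul1n drop0.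
rewrite bits_of_nat_gt0 ?muln_gt0 ?expn_gt0 //= expnS -mulnA mul2n doubleK.
exact: IH.
Qed.

Lemma size_bits_of_nat n k : n < 2 ^ k -> size (bits_of_nat n) <= k.
Proof. by move=> lt_n; rewrite size_mkseq; apply: up_log_min. Qed.

Lemma nseq_catS (T : Type) n (x : T) s : nseq n x ++ x :: s = x :: nseq n x ++ s.
Proof. by elim: n => //= n ->. Qed.

(** * Elementary tape routines *)

Section Pieces.
Variable k : nat.

(** Each of the [k] answers has a tape of its own, so that all of them can be read in parallel. *)
Definition tape_name : finType := (bool + option 'I_k)%type.
Definition inp : tape_name := inl false.
Definition orc : tape_name := inl true.
Definition out : tape_name := inr None.
Definition ans (t : 'I_k) : tape_name := inr (Some t).

Definition tuple_on (T : Type) (a b c : T) (d : 'I_k -> T) (i : tape_name) : T :=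
  match i with
  | inl false => a
  | inl true => b
  | inr None => c
  | inr (Some t) => d t
  end.

Lemma tuple_on_eq a b c d a' b' c' d' :
  tape_eq a a' -> tape_eq b b' -> tape_eq c c' -> (forall t, tape_eq (d t) (d' t)) ->
  forall i, tape_eq (tuple_on a b c d i) (tuple_on a' b' c' d' i).
Proof. by move=> Ha Hb Hc Hd [[]|[t|]] //=. Qed.

Variables (S : finType) (O : seq bool -> seq bool).
Local Notation instr := (instr tape_name S).
Local Notation exec := (@exec tape_name S orc O).
Implicit Types (s : S) (r : tape_name -> cell) (ts : tape_name -> tape).

Definition keep r i : cell * direction := (r i, Stay).

Lemma upd_keep (a : tape_name -> cell * direction) ts i :
  a i = keep (fun i => read (ts i)) i -> tape_eq (upd a ts i) (ts i).
Proof. by rewrite /upd => -> /=; apply: tape_eq_write_read. Qed.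

Lemma exec_exit1 f s ts s1 a ts' :
  f s (fun i => read (ts i)) = (false, s1, a) ->
  (forall i, tape_eq (upd a ts i) (ts' i)) ->
  exec [:: Loop f] 1 s ts s1 ts'.
Proof. by move=> Ef e; apply: exec_exit Ef _; apply: exec_nil. Qed.

Lemma exec_keep f s ts :
  f s (fun i => read (ts i)) = (false, s, keep (fun i => read (ts i))) ->
  exec [:: Loop f] 1 s ts s ts.
Proof. by move=> Ef; apply: exec_exit1 Ef _ => i; apply: upd_keep. Qed.

(** The unary order at the start of the input serves as a counter: one [b] is written per leading
    1. *)
Definition pad b : instr := Loop (fun s r =>
  if r inp == Some true
  then (true, s, tuple_on (r inp, MoveRight) (Some b, MoveRight) (r out, Stay)
                   (fun t => (r (ans t), Stay)))
  else (false, s, keep r)).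

Lemma exec_pad b n s l (x : cell) u l' o d :
  x != Some true ->
  exec [:: pad b] n.+1 s
    (tuple_on (Tape l (nseq n (Some true) ++ x :: u)) (Tape l' [::]) o d) s
    (tuple_on (Tape (nseq n (Some true) ++ l) (x :: u))
       (Tape (nseq n (Some b) ++ l') [::]) o d).
Proof.
move=> nx; elim: n l l' => [|n IH] l l'.
  by apply: exec_keep; rewrite /= /read /= (negbTE nx).
apply: exec_again; first by [].
have := IH (Some true :: l) (Some b :: l'); rewrite !nseq_catS.
apply: exec_tape_eq.
by case=> [[]|[t|]] //=; apply: upd_keep.
Qed.

Definition emit b : instr := Loop (fun s r =>
  (false, s, tuple_on (r inp, Stay) (Some b, MoveRight) (r out, Stay)
               (fun t => (r (ans t), Stay)))).

Lemma exec_emit w s i l o d :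
  exec (map emit w) (size w) s (tuple_on i (Tape l [::]) o d) s
    (tuple_on i (Tape (map Some (rev w) ++ l) [::]) o d).
Proof.
elim: w l => [|b w IH] l; first exact: exec_nil.
apply: exec_exit; first by [].
rewrite rev_cons map_rcons cat_rcons; apply: exec_tape_eq (IH _).
by case=> [[]|[t|]] //=; apply: upd_keep.
Qed.

Definition copy : instr := Loop (fun s r =>
  if r inp is Some b
  then (true, s, tuple_on (Some b, MoveRight) (Some b, MoveRight) (r out, Stay)
                   (fun t => (r (ans t), Stay)))
  else (false, s, keep r)).

Lemma exec_copy w s l l' o d :
  exec [:: copy] (size w).+1 s
    (tuple_on (Tape l (map Some w)) (Tape l' [::]) o d) s
    (tuple_on (Tape (map Some (rev w) ++ l) [::])
       (Tape (map Some (rev w) ++ l') [::]) o d).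
Proof.
elim: w l l' => [|b w IH] l l'; first by apply: exec_keep.
apply: exec_again; first by [].
rewrite rev_cons map_rcons !cat_rcons; apply: exec_tape_eq (IH _ _).
by case=> [[]|[t|]] //=; apply: upd_keep.
Qed.

(** The oracle tape is erased while it is copied, so that the next query starts on a blank tape. *)
Definition save t : instr := Loop (fun s r =>
  if r orc is Some b
  then (true, s, tuple_on (r inp, Stay) (None, MoveRight) (r out, Stay)
         (fun t' => if t' == t then (Some b, MoveRight) else (r (ans t'), Stay)))
  else (false, s, keep r)).

Lemma exec_save t w s i z l o d : d t = Tape l [::] ->
  exec [:: save t] (size w).+1 s
    (tuple_on i (Tape (nseq z None) (map Some w)) o d) s
    (tuple_on i (Tape (nseq (size w + z) None) [::]) o
       (fun t' => if t' == t then Tape (map Some (rev w) ++ l) [::] else d t')).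
Proof.
elim: w l z d => [|b w IH] l z d Edt.
  apply: exec_tape_eq; last by apply: exec_keep.
  by apply: tuple_on_eq => // t'; case: eqP => // ->; rewrite Edt.
apply: exec_again; first by [].
rewrite rev_cons map_rcons !cat_rcons [size (b :: w)]/= addSnnS.
pose d1 t' := if t' == t then Tape (Some b :: l) [::] else d t'.
have Ed1 : d1 t = Tape (Some b :: l) [::] by rewrite /d1 eqxx.
apply: exec_tape_eq (exec_leq (leqnn _) _); last first.
  have -> : (fun t' => if t' == t then Tape (map Some (rev w) ++ Some b :: l) [::] else d t')
     = (fun t' => if t' == t then Tape (map Some (rev w) ++ Some b :: l) [::] else d1 t').
    by apply: functional_extensionality => t'; rewrite /d1; case: eqP.
  exact: IH Ed1.
case=> [[]|[t'|]] //=; try exact: upd_keep.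
rewrite /upd /= /d1; case: eqP => [-> | ne]; first by rewrite Edt.
exact: tape_eq_write_read.
Qed.

Definition on_tape j (c : cell * direction) r (i : tape_name) : cell * direction :=
  if i == j then c else (r i, Stay).

Lemma upd_on_tape j c ts us :
  tape_eq (move_head c.2 (write c.1 (ts j))) (us j) ->
  (forall i, i != j -> tape_eq (ts i) (us i)) ->
  forall i, tape_eq (upd (on_tape j c (fun i => read (ts i))) ts i) (us i).
Proof.
move=> Hj Hi i; rewrite /upd /on_tape; case: eqP => [-> //|/eqP /Hi e].
exact: tape_eq_trans (tape_eq_write_read _) e.
Qed.

Definition move_on j dir : instr := Loop (fun s r => (false, s, on_tape j (r j, dir) r)).

Definition go_left j : instr := Loop (fun s r =>
  if r j is Some b then (true, s, on_tape j (Some b, MoveLeft) r)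
  else (false, s, on_tape j (None, MoveRight) r)).

(** Here [w] lists the scanned cell and those to its left, nearest first. For empty [w] the default
    [None] is the blank in front of the word, from which the head steps back right. *)
Lemma exec_go_left j w u s ts ts' :
  tape_eq (ts j) (Tape (behead (map Some w)) (head None (map Some w) :: u)) ->
  (forall i, i != j -> tape_eq (ts i) (ts' i)) ->
  tape_eq (ts' j) (Tape [::] (map Some (rev w) ++ u)) ->
  exec [:: go_left j] (size w).+1 s ts s ts'.
Proof.
elim: w u ts => [|b w IH] u ts Ej Ei Ej'.
  apply: exec_exit1; first by rewrite /= (tape_eq_read Ej).
  apply: upd_on_tape => //=; apply: tape_eq_trans (tape_eq_sym Ej').
  apply: tape_eq_trans (tape_eq_move MoveRight (tape_eq_write None Ej)) _.
  by split=> //= -[|[]].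
apply: exec_again; first by rewrite /= (tape_eq_read Ej).
apply: (IH (Some b :: u)).
- rewrite /upd /on_tape eqxx /=.
  exact: tape_eq_trans (tape_eq_move MoveLeft (tape_eq_write (Some b) Ej)) _.
- move=> i ne; rewrite /upd /on_tape (negbTE ne) /=.
  exact: tape_eq_trans (tape_eq_write_read _) (Ei _ ne).
- by move: Ej'; rewrite rev_cons map_rcons cat_rcons.
Qed.

(** The head may stand on the blank after the word, which would stop [go_left] at once; hence the
    initial move. *)
Definition rewind j : seq instr := [:: move_on j MoveLeft; go_left j].

Lemma move_left_tape_eq (w : seq bool) u t :
  tape_eq t (Tape (map Some w) u) ->
  tape_eq (move_head MoveLeft (write (read t) t))
    (Tape (behead (map Some w)) (head None (map Some w) :: u)).
Proof.
move=> e; apply: tape_eq_trans (tape_eq_move MoveLeft (tape_eq_write_read t)) _.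
exact: (tape_eq_move MoveLeft e).
Qed.

Lemma exec_rewind j w u s ts ts' :
  tape_eq (ts j) (Tape (map Some w) u) ->
  (forall i, i != j -> tape_eq (ts i) (ts' i)) ->
  tape_eq (ts' j) (Tape [::] (map Some (rev w) ++ u)) ->
  exec (rewind j) (size w).+2 s ts s ts'.
Proof.
move=> Ej Ei Ej'; apply: exec_exit; first by [].
apply: (@exec_go_left _ _ u) => //.
  by rewrite /upd /on_tape eqxx; apply: move_left_tape_eq.
move=> i ne; rewrite /upd /on_tape (negbTE ne) /=.
exact: tape_eq_trans (tape_eq_write_read _) (Ei _ ne).
Qed.

Definition trim : instr := Loop (fun s r =>
  if r out == Some false then (true, s, on_tape out (None, MoveLeft) r)
  else (false, s, keep r)).

(** The default in [head true w] admits the empty [w], which arises for the number 0. The word [u]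
    collects the cells already erased. *)
Lemma exec_trim z w u s ts ts' :
  nth None u =1 (fun=> None) -> head true w ->
  tape_eq (ts out) (Tape (behead (map Some (nseq z false ++ w)))
                         (head None (map Some (nseq z false ++ w)) :: u)) ->
  (forall i, i != out -> tape_eq (ts i) (ts' i)) ->
  tape_eq (ts' out) (Tape (behead (map Some w)) [:: head None (map Some w)]) ->
  exec [:: trim] z.+1 s ts s ts'.
Proof.
move=> + hw; elim: z u ts => [|z IH] u ts Eu Ej Ei Ej'.
  apply: exec_exit1.
    by rewrite (tape_eq_read Ej) /read; case: w hw {Ej Ej'} => [|[]].
  move=> i; apply: tape_eq_trans (upd_keep _) _ => //.
  have [-> | ne] := eqVneq i out; last exact: Ei.
  apply: tape_eq_trans Ej (tape_eq_trans _ (tape_eq_sym Ej')).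
  by split=> //= -[|i'] //=; rewrite Eu nth_nil.
apply: exec_again; first by rewrite (tape_eq_read Ej) /read /=.
apply: (IH (None :: u)) => //; first by case.
- rewrite /upd /on_tape eqxx.
  exact: tape_eq_trans (tape_eq_move MoveLeft (tape_eq_write None Ej)) _.
- move=> i ne; rewrite /upd /on_tape (negbTE ne) /=.
  exact: tape_eq_trans (tape_eq_write_read _) (Ei _ ne).
Qed.

(** The output is read from the scanned cell on, so moving the head right past [a] cells deletes the
    [a] lowest bits. *)
Lemma exec_skip a s ts l u :
  tape_eq (ts out) (Tape l u) ->
  exists2 ts', exec (nseq a (move_on out MoveRight)) a s ts s ts' &
    exists l', tape_eq (ts' out) (Tape l' (drop a u)).
Proof.
elim: a s ts l u => [|a IH] s ts l u e.
  by exists ts; [exact: exec_nil | exists l; rewrite drop0].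
have [|ts' ex [l' e']] := IH s
  (upd (on_tape out (read (ts out), MoveRight) (fun i => read (ts i))) ts)
  (head None u :: l) (behead u).
  rewrite /upd /on_tape eqxx /=.
  apply: tape_eq_trans (tape_eq_move MoveRight (tape_eq_write_read _)) _.
  exact: (tape_eq_move MoveRight e).
exists ts'; first by apply: exec_exit ex.
by exists l'; move: e'; case: (u) => //=; case: (a).
Qed.

(** * Writing a query and saving its answer *)

Definition column w : seq instr := pad false :: map emit w ++ rewind inp.

Lemma exec_columns ws n s u l o d :
  exec (flatten (map column ws)) (sumn [seq 5 + size w | w <- ws] * n.+1) s
    (tuple_on (Tape [::] (nseq n (Some true) ++ Some false :: u)) (Tape l [::]) o d) s
    (tuple_on (Tape [::] (nseq n (Some true) ++ Some false :: u))
       (Tape (map Some (rev (flatten [seq nseq n false ++ w | w <- ws])) ++ l) [::]) o d).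
Proof.
elim: ws l => [|w ws IH] l; first exact: exec_nil.
rewrite [flatten _]/= [sumn _]/= mulnDl -cat_cons.
rewrite [flatten [seq _ ++ _ | w <- _ :: _]]/= !rev_cat !map_cat -!catA.
apply: exec_cat (IH _).
(* Padding, emitting [w] and rewinding over the n ones of the input. *)
apply: exec_leq (_ : n.+1 + (size w + n.+2) <= _) _; first by nia.
rewrite -cat1s; apply: exec_cat; first exact: exec_pad.
apply: exec_cat; first exact: exec_emit.
rewrite -[n in n.+2](size_nseq n true).
apply: (@exec_rewind _ _ (Some false :: u)).
- by rewrite /= cats0 map_nseq.
- by case=> [[]|[t|]] //= _; rewrite rev_nseq map_nseq.
- by rewrite /= rev_nseq map_nseq.
Qed.

(** The query is written in the order of its encoding: n ones counted off the input, the ones for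
    [K], the closing 0 and triangle copied from the input, then the new columns. *)
Definition ask_dunion (K : irreflexive_graph) t : seq instr :=
  pad true :: map emit (nseq (graph_order K) true) ++ copy :: rewind inp ++
  flatten [seq column (graph_column j) | j <- enum 'I_(graph_order K)] ++
  rewind orc ++ Ask :: save t :: rewind (ans t).

Definition column_cost (K : irreflexive_graph) : nat :=
  sumn [seq 5 + size (graph_column j) | j <- enum 'I_(graph_order K)].

Definition ask_cost K : nat := 20 + (graph_order K).*2 + (column_cost K).*2.

(** For fixed [K] there is a fixed number of new columns, each with n zeros and a constant word, so
    the query has linear length. This bounds the rewinding of the oracle tape. *)
Lemma size_encode_dunion K G :
  size (encode_graph (dunion G K))
  <= ((graph_order K).+1 + column_cost K) * size (encode_graph G).
Proof.
rewrite !encode_graphE triangle_dunion !size_cat /= !size_nseq size_cat size_flatten.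
rewrite /shape -map_comp.
set x := sumn _.
have: x <= column_cost K * (graph_order G).+1.
  rewrite /x /column_cost; elim: (enum _) => //= j js IH.
  by rewrite size_cat size_nseq mulnDl; nia.
set T := size (triangle G); nia.
Qed.

Lemma exec_ask_dunion K t (G : irreflexive_graph) w s o d :
  O (encode_graph (dunion G K)) = w -> d t = load [::] ->
  exec (ask_dunion K t) (ask_cost K * (size (encode_graph G) + size w)) s
    (tuple_on (load (encode_graph G)) (load [::]) o d) s
    (tuple_on (load (encode_graph G)) (load [::]) o
       (fun t' => if t' == t then load w else d t')).
Proof.
move=> Ow Edt.
set n := graph_order G; set m := graph_order K.
pose e := encode_graph (dunion G K).
pose cols := [seq graph_column j | j <- enum 'I_m].
pose inpG := Tape [::] (nseq n (Some true) ++ Some false :: map Some (triangle G)).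
have EinpG : load (encode_graph G) = inpG.
  by rewrite /load encode_graphE map_cat map_nseq.
have Ee : e = nseq (n + m) true ++ (false :: triangle G) ++
              flatten [seq nseq n false ++ w | w <- cols].
  by rewrite /e encode_graphE triangle_dunion /cols -map_comp.
(* In order: pad, emit, copy, rewind the input, columns, rewind the oracle tape, ask, save, rewind
   the answer. *)
apply: exec_leq (_ : n.+1 + (size (nseq m true) + ((size (triangle G)).+2 +
   ((size (encode_graph G)).+2 + (column_cost K * n.+1 +
   ((size e).+2 + (1 + ((size w).+1 + (size w).+2))))))) <= _) _.
  have := size_encode_dunion K G; rewrite -/e /ask_cost.
  rewrite encode_graphE size_cat /= !size_nseq -/n -/m.
  set T := size (triangle G); set c := column_cost K; nia.
rewrite EinpG /ask_dunion -cat1s.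
apply: exec_cat; first exact: exec_pad.
apply: exec_cat; first exact: exec_emit.
rewrite -cat1s; apply: exec_cat; first exact: (@exec_copy (false :: triangle G)).
apply: (@exec_cat _ _ _ _ _ _ _ _ _ (tuple_on inpG
    (Tape (map Some (rev (nseq (n + m) true ++ false :: triangle G))) [::]) o d)).
  have -> : size (encode_graph G) = size (rev (encode_graph G)) by rewrite size_rev.
  apply: (@exec_rewind _ _ [::]).
  - by rewrite encode_graphE rev_cat map_cat !rev_nseq !map_nseq cats0.
  - case=> [[]|[t'|]] //= _.
    by rewrite rev_cat nseqD rev_cat !map_cat !rev_nseq !map_nseq cats0.
  - by rewrite revK cats0 /= encode_graphE map_cat map_nseq.
apply: exec_cat.
  rewrite (map_comp column) [column_cost K](_ : _ = sumn [seq 5 + size w | w <- cols]).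
    exact: exec_columns.
  by rewrite /cols -map_comp.
apply: (@exec_cat _ _ _ _ _ _ _ _ _ (tuple_on inpG (load e) o d)).
  have -> : size e = size (rev e) by rewrite size_rev.
  apply: (@exec_rewind _ _ [::]).
  - by rewrite -map_cat -rev_cat Ee -catA.
  - by case=> [[]|[t'|]].
  - by rewrite revK cats0.
apply: exec_ask.
apply: (@exec_tape_eq _ _ _ _ _ _ _ (tuple_on inpG (Tape (nseq 0 None) (map Some w)) o d)).
  by case=> [[]|[t'|]] //; rewrite /asked /= contents_word Ow.
rewrite -cat1s; apply: exec_cat; first exact: exec_save Edt.
rewrite -[X in X.+2](size_rev w).
apply: (@exec_rewind _ _ [::]).
- by rewrite /= eqxx cats0.
(* The blanks that [save] leaves on the oracle tape are equivalent to an empty tape. *)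
- case=> [[]|[t'|]] //=; first by split=> //= i; rewrite nth_nseq if_same nth_nil.
  by move=> ne; case: eqP => // E; rewrite E eqxx in ne.
- by rewrite /= eqxx revK cats0.
Qed.

End Pieces.

(** Each query restores the input and oracle tapes, and [uniq ts] keeps each answer tape blank until
    its turn. *)
Lemma exec_asks k (S : finType) O (K : 'I_k -> irreflexive_graph) (ts : seq 'I_k)
    G (w : 'I_k -> seq bool) L (s : S) o d :
  uniq ts -> (forall t, O (encode_graph (dunion G (K t))) = w t) ->
  (forall t, size (w t) <= L) -> {in ts, forall t, d t = load [::]} ->
  exec (orc k) O (flatten [seq ask_dunion S (K t) t | t <- ts])
    (sumn [seq ask_cost (K t) | t <- ts] * (size (encode_graph G) + L)) s
    (tuple_on (load (encode_graph G)) (load [::]) o d) s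
    (tuple_on (load (encode_graph G)) (load [::]) o
       (fun t => if t \in ts then load (w t) else d t)).
Proof.
move=> + HO HL; elim: ts d => [|t ts IH] d.
  by move=> _ _; apply: exec_nil.
rewrite cons_uniq => /andP[nt uts] Hd.
rewrite (_ : flatten _ = ask_dunion S (K t) t ++ flatten [seq ask_dunion S (K t) t | t <- ts]) //.
rewrite (_ : sumn _ = ask_cost (K t) + sumn [seq ask_cost (K t) | t <- ts]) // mulnDl.
apply: exec_cat.
  apply: exec_leq (exec_ask_dunion _ _ (HO t) _); last by apply: Hd; rewrite mem_head.
  by rewrite leq_mul2l leq_add2l HL orbT.
set d1 := fun t' => if t' == t then load (w t) else d t'.
have Hd1 : {in ts, forall t', d1 t' = load [::]}.
  move=> t' t'ts; rewrite /d1; case: eqP t'ts => [->|_] t'ts; first by rewrite t'ts in nt.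
  by apply: Hd; rewrite inE t'ts orbT.
have := IH d1 uts Hd1; congr exec; congr tuple_on.
apply: functional_extensionality => t'; rewrite inE /d1.
by case: eqP => [->|_] //=; rewrite (negbTE nt).
Qed.

(** * Exact division of a signed combination of binary numbers *)

Section Division.
Local Open Scope ring_scope.
Variables (k : nat) (l : 'I_k -> int) (m : nat).
Hypothesis odd_m : odd m.

(** For B this bound and |c| <= B, the pending sum plus or minus m has absolute value at most 2B, so
    halving leads back to [-B, B]. The register stores the signed carry shifted by B. *)
Definition carry_bound : nat := (\sum_t `|l t| + m)%N.
Definition carry := 'I_(carry_bound.*2.+1).
Definition int_of_carry (s : carry) : int := (s : nat)%:Z - carry_bound%:Z.
Definition carry_of_int (c : int) : carry := inord `|c + carry_bound%:Z|.

Lemma carry_of_intK c : `|c| <= carry_bound%:Z -> int_of_carry (carry_of_int c) = c.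
Proof. by move=> Hc; rewrite /int_of_carry inordK; lia. Qed.

Definition digit_sum (c : int) (b : 'I_k -> bool) : int := c + \sum_t l t * (b t)%:R.

Definition next_carry (v : int) : int := ((v - (m * odd `|v|)%:Z) %/ 2)%Z.

(** As m is odd, subtracting it from an odd v leaves an even number, so the halving is exact. *)
Lemma next_carryE v : v = 2 * next_carry v + (m * odd `|v|)%:Z.
Proof.
have Ev : (2 %| v - (m * odd `|v|)%:Z)%Z.
  by move: odd_m; case: (boolP (odd `|v|)); rewrite ?muln1 ?muln0 ; lia.
by rewrite mulrC divzK // subrK.
Qed.

Lemma next_carry_bound c b : `|c| <= carry_bound%:Z ->
  `|next_carry (digit_sum c b)| <= carry_bound%:Z.
Proof.
move=> Hc; have Hs : `|\sum_t l t * (b t)%:R| <= (\sum_t `|l t|)%N%:Z.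
  apply: le_trans (ler_norm_sum _ _ _) _; rewrite (big_morph Posz PoszD (erefl _)).
  by apply: ler_sum => t _; case: (b t); rewrite ?mulr1 ?mulr0 ?normr0 // abszE.
have Edef : digit_sum c b = c + \sum_t l t * (b t)%:R by [].
move: Hc Hs (next_carryE (digit_sum c b)) Edef; rewrite /carry_bound.
move: (digit_sum c b) (\sum_t l t * _) (\sum_t _)%N => v x y.
by case: (odd _); rewrite ?muln1 ?muln0; move: (next_carry v) => z; lia.
Qed.

(* Since m is odd, the next quotient bit is the parity of the pending sum. *)
Definition divide : instr (tape_name k) carry := Loop (fun s r =>
  if (int_of_carry s == 0) && [forall t, r (ans t) == None] then (false, s, keep r)
  else let v := digit_sum (int_of_carry s) (fun t => r (ans t) == Some true) in
    (true, carry_of_int (next_carry v),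
     tuple_on (r (inp k), Stay) (r (orc k), Stay) (Some (odd `|v|), MoveRight)
       (fun t => (r (ans t), MoveRight)))).

Lemma exec_divide_stop O n c (A : 'I_k -> seq bool) X i q u L :
  c = 0 -> (forall t, A t = [::]) ->
  c + \sum_t l t * (nat_of_bits (A t))%:R = (m * X)%N%:Z ->
  exists o d s', [/\ nat_of_bits o = X, (size o <= n)%N &
    exec (orc k) O [:: divide] n.+1 (carry_of_int c)
      (tuple_on i q (Tape u [::]) (fun t => Tape (L t) (map Some (A t)))) s'
      (tuple_on i q (Tape (map Some (rev o) ++ u) [::]) d)].
Proof.
move=> -> A0 Esum.
exists [::], (fun t => Tape (L t) (map Some (A t))), (carry_of_int 0); split=> //.
  move: Esum; rewrite big1 => [|t _]; last by rewrite A0 mulr0.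
  by have := odd_gt0 odd_m; rewrite /=; nia.
apply: (@exec_leq _ _ _ _ _ 1) => //; apply: exec_keep.
rewrite carry_of_intK // eqxx /= ifT //.
by apply/forallP => t; rewrite A0.
Qed.

(** The last hypothesis is the invariant: carry plus combination of the unread suffixes equals m
    times the remaining quotient [X]. Each round peels off one bit of [X], and [n] bounds the number
    of rounds. *)
Lemma exec_divide O n c (A : 'I_k -> seq bool) X i q u L :
  `|c| <= carry_bound%:Z -> (forall t, size (A t) <= n)%N -> (X < 2 ^ n)%N ->
  c + \sum_t l t * (nat_of_bits (A t))%:R = (m * X)%N%:Z ->
  exists o d s', [/\ nat_of_bits o = X, (size o <= n)%N &
    exec (orc k) O [:: divide] n.+1 (carry_of_int c)
      (tuple_on i q (Tape u [::]) (fun t => Tape (L t) (map Some (A t)))) s'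
      (tuple_on i q (Tape (map Some (rev o) ++ u) [::]) d)].
Proof.
elim: n c A X u L => [|n IH] c A X u L Hc HA HX Esum;
  have [/andP[/eqP c0 /forallP A0] | go] := boolP ((c == 0) && [forall t, A t == [::]]);
  try by apply: exec_divide_stop c0 (fun t => eqP (A0 t)) Esum.
  (* For n = 0 all suffixes are empty and [X] is 0, so the invariant forces c = 0 and the loop must
     stop. *)
  case/negP: go; have HA0 t : A t = [::] by apply/nilP; rewrite /nilp -leqn0.
  apply/andP; split; last by apply/forallP => t; rewrite HA0.
  move: Esum; rewrite big1 => [|t _]; last by rewrite HA0 mulr0.
  by move: HX; case: X => // _; rewrite muln0 addr0 => ->.
(* An exhausted answer contributes zero digits. *)
pose b t := head false (A t).
pose v := digit_sum c b.
have Ev : v + 2 * \sum_t l t * (nat_of_bits (behead (A t)))%:R = (m * X)%N%:Z.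
  rewrite -Esum /v /digit_sum -addrA mulr_sumr -big_split /=; congr (_ + _).
  apply: eq_bigr => t _; rewrite /b; case: (A t) => [|x w] /=; first by ring.
  by rewrite -muln2 natrD natrM; ring.
(* The invariant modulo 2 gives v = mX, and m is odd. *)
have Hodd : odd `|v| = odd X.
  have : odd `|v| = odd (m * X)%N.
    by move: Ev; set y := \sum_t _; lia.
  by rewrite oddM odd_m.
have Ev' := next_carryE v.
have [|||o [d [s' [Eo so ex]]]] := IH (next_carry v) (fun t => behead (A t)) X./2
  (Some (odd X) :: u) (fun t => head None (map Some (A t)) :: L t)
  (next_carry_bound _ Hc).
- by move=> t; rewrite size_behead; have := HA t; lia.
- by move: HX; rewrite expnS; lia.
- rewrite Hodd in Ev'; move: Ev Ev'; set y := \sum_t _; set z := next_carry v.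
  by rewrite -[in (m * X)%N](odd_double_half X) mulnDr; case: (odd X); nia.
exists (odd X :: o), d, s'; split=> //=; first by rewrite Eo odd_double_half.
rewrite rev_cons map_rcons cat_rcons.
have Edig : digit_sum c (fun t => read (Tape (L t) (map Some (A t))) == Some true) = v.
  by congr (_ + _); apply: eq_bigr => t _; rewrite /b /read; case: (A t) => [|[]].
apply: exec_again.
  rewrite /= carry_of_intK // Edig Hodd ifN //.
  apply: contra go => /andP[-> /forallP Hb] /=.
  by apply/forallP => t; have := Hb t; rewrite /read /=; case: (A t).
apply: exec_tape_eq ex.
case=> [[]|[t|]] /=; try exact: upd_keep; rewrite /upd //=.
by case: (A t).
Qed.

End Division.

(** * The reduction *)

(** Step onto the most significant bit, erase leading zeros, return to the lowest bit, and skip [a]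
    bits. *)
Definition finish k (S : finType) a : seq (instr (tape_name k) S) :=
  [:: move_on S (out k) MoveLeft; trim k S; go_left S (out k)]
  ++ nseq a (move_on S (out k) MoveRight).

Lemma exec_finish k (S : finType) O a n (s : S) i q o d :
  nat_of_bits o = 2 ^ a * n ->
  exists2 ts, exec (orc k) O (finish k S a) (3 + (size o).*2 + a) s
    (tuple_on i q (Tape (map Some (rev o)) [::]) d) s ts
  & contents (ts (out k)) = bits_of_nat n.
Proof.
move=> Eo; set v := bits_of_nat (2 ^ a * n).
have [z] := nat_of_bitsK o; rewrite Eo -/v => Ov.
set ts0 := tuple_on _ _ _ _.
pose ts1 := tuple_on i q (Tape [::] (map Some v)) d.
have [|ts ex [l' e]] := @exec_skip k S O a s ts1 [::] (map Some v); first by [].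
exists ts; last first.
  by rewrite (tape_eq_contents e) -map_drop contents_word drop_bits_of_nat.
apply: exec_cat ex.
have Erev : rev o = nseq z false ++ rev v by rewrite Ov rev_cat rev_nseq.
have so : size o = z + size (rev v) by rewrite -size_rev Erev size_cat size_nseq.
apply: (@exec_leq _ _ _ _ _ (1 + (z.+1 + (size (rev v)).+1))); first by rewrite so; lia.
pose cells := map Some (rev v).
pose cells0 := map Some (rev o).
apply: (@exec_cat _ _ _ _ [:: _] _ _ _ _
  (tuple_on i q (Tape (behead cells0) [:: head None cells0]) d)).
  apply: exec_exit1; first by [].
  apply: upd_on_tape; first exact: move_left_tape_eq.
  by case=> [[]|[t|]].
apply: (@exec_cat _ _ _ _ [:: _] _ _ _ _
  (tuple_on i q (Tape (behead cells) [:: head None cells]) d)).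
  apply: (@exec_trim _ _ _ z (rev v) [::]) => //.
  - by move=> j; rewrite nth_nil.
  - rewrite /v; have [-> | /bits_of_nat_last[w ->]] := posnP (2 ^ a * n).
      by rewrite bits_of_nat0.
    by rewrite rev_rcons.
  - by rewrite -Erev.
  - by case=> [[]|[t|]].
apply: (@exec_go_left _ _ _ _ (rev v) [::]) => //; first by case=> [[]|[t|]].
by rewrite revK cats0.
Qed.

Lemma leq_exp_exp2 (b e : nat) : b ^ e <= 2 ^ (b * e).
Proof.
rewrite expnM; elim: e => // e IH.
by rewrite !expnS leq_mul // ltnW // ltn_expl.
Qed.

(** This keeps the number of binary digits linear in the order of [G]. *)
Lemma num_hom_leq (G : irreflexive_graph) (H : graph) :
  num_hom G H <= 2 ^ (#|H| * graph_order G).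
Proof.
apply: leq_trans (leq_exp_exp2 _ _).
by rewrite -[graph_order G]card_ord -card_ffun; apply: max_card.
Qed.

Lemma num_compaction_leq (G : irreflexive_graph) (H : graph) :
  num_compaction G H <= 2 ^ (#|H| * graph_order G).
Proof.
apply: leq_trans (num_hom_leq G H); apply: subset_leq_card.
by apply/subsetP => h; rewrite !inE => /and3P[].
Qed.

Theorem theorem3p4 (H : graph) :
  poly_time_Turing_reducible (count_hom H) (count_comp H).
Proof.
have [k [l [K [d [d_gt0 interp]]]]] := num_hom_interpolation H.
have [m co_m Ed] := pfactor_coprime (isT : prime 2) d_gt0.
set a := logn 2 d in Ed.
have odd_m : odd m by rewrite -coprime2n.
pose S := carry l m.
pose prog := flatten [seq ask_dunion S (K t) t | t <- enum 'I_k]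
  ++ [:: divide l m] ++ finish k S a.
pose c1 := sumn [seq ask_cost (K t) | t <- enum 'I_k].
(* [F * N] bounds the digits of every answer and of [2 ^ a * num_hom G H]: the first summand covers
   [G] with any [K t], [a] the power of 2, and 1 makes the bound strict. *)
pose F := #|H| * (\sum_t graph_order (K t)).+1 + a + 1.
(* The stages cost [c1 * (N + F * N)] for the queries, [F * N + 1] for the division and at most
   [3 + 2 * (F * N) + a] for the finish, so the total time is linear. *)
pose C := c1 * F.+1 + F * 3 + a + 4.
exists (program_machine (inp k) (orc k) (out k) prog (carry_of_int l m 0)).
exists (C%:P * 'X)%R => O HO G.
rewrite hornerM hornerC hornerX; set N := size _.
have N_gt : graph_order G < N.
  by rewrite /N /= encode_graphE size_cat size_nseq /= -addSnnS leq_addr.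
have N_gt0 : 0 < N by apply: leq_ltn_trans N_gt.
pose w t := bits_of_nat (num_compaction (dunion G (K t)) H).
have Hw t : size (w t) <= F * N.
  apply: size_bits_of_nat; apply: leq_ltn_trans (num_compaction_leq _ _) _.
  rewrite ltn_exp2l // /= /F.
  have : graph_order (K t) <= \sum_t graph_order (K t).
    by rewrite (bigD1 t) //= leq_addr.
  set sK := \sum_t _ => leK.
  have : #|H| * (graph_order G + graph_order (K t)) <= #|H| * (sK.+1 * N).
    by rewrite leq_mul2l; apply/orP; right; nia.
  rewrite !mulnDl mul1n -mulnA => /leq_ltn_trans; apply.
  by rewrite -addnA -[ltnLHS]addn0 ltn_add2l addn_gt0 N_gt0 orbT.
have HX : 2 ^ a * num_hom G H < 2 ^ (F * N).
  apply: leq_ltn_trans (leq_mul (leqnn _) (num_hom_leq _ _)) _.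
  rewrite -expnD ltn_exp2l // /F; set sK := \sum_t _.
  have : #|H| * graph_order G <= #|H| * (sK.+1 * N).
    by rewrite leq_mul2l; apply/orP; right; nia.
  rewrite !mulnDl mul1n -mulnA; move: N_gt0 (leq_pmulr a N_gt0).
  by move: (a * N) (#|H| * _) (#|H| * _) => x y z; lia.
(* The interpolation identity is the division invariant with carry 0, since [d] is [m * 2 ^ a]. *)
have Esum : (0 + \sum_t l t * (nat_of_bits (w t))%:R = (m * (2 ^ a * num_hom G H))%N%:Z)%R.
  rewrite add0r mulnA -Ed -natz natrM interp.
  by apply: eq_bigr => t _; rewrite bits_of_natK.
have [|o [ds [s' [Eo so exd]]]] :=
  @exec_divide k l m odd_m O (F * N) 0%R w (2 ^ a * num_hom G H)
    (load (encode_graph G)) (load [::]) [::] (fun=> [::]) _ Hw HX Esum.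
  by rewrite normr0.
have [ts exf Ets] := @exec_finish k S O a (num_hom G H) s'
  (load (encode_graph G)) (load [::]) o ds Eo.
apply: exec_outputs_within Ets.
have HO' t : O (encode_graph (dunion G (K t))) = w t by apply: HO.
have exa := @exec_asks k S O K (enum 'I_k) G w (F * N) (carry_of_int l m 0)
  (load [::]) (fun=> load [::]) (enum_uniq _) HO' Hw (fun _ _ => erefl).
apply: (@exec_leq _ _ _ _ _ (c1 * (N + F * N) + ((F * N).+1 + (3 + (size o).*2 + a)))).
  rewrite -[(C * N)%R]/(C * N) /C; move: so; set x := F * N; set y := size o; nia.
apply: exec_tape_eq (exec_cat exa _); first by case=> [[]|[t|]].
apply: exec_cat exf; apply: exec_tape_eq; last first.
  by move: exd; rewrite cats0; apply.
by apply: tuple_on_eq => // t; rewrite mem_enum.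
Qed.
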